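(* Let $u$ be a (nonempty) word. If $\mathbf{V}=[u=0]$, then $\mathbf{V}$ is either locally $\mathcal{H}$-finite or not locally $\mathcal{J}$-finite.
   Context: $[u=0]$ denotes the variety of all semigroups $S$ with a zero $0$ in which every substitution of elements of $S$ for the letters of $u$ gives the value $0$ (equivalently, the semigroup variety defined by the identities $uy=yu=u$, where $y$ is a letter not occurring in $u$). On a semigroup $S$: $a\,\mathcal{L}\,b \iff S^1a=S^1b$; $a\,\mathcal{R}\,b\iff aS^1=bS^1$; $a\,\mathcal{J}\,b\iff S^1aS^1=S^1bS^1$; $\mathcal{H}=\mathcal{L}\cap\mathcal{R}$. For $\mathcal{K}\in\{\mathcal{H},\mathcal{J}\}$, a semigroup is $\mathcal{K}$-finite if it has only finitely many distinct $\mathcal{K}$-classes, and a variety is locally $\mathcal{K}$-finite if each of its finitely generated members is $\mathcal{K}$-finite. *)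

(* Defs.v *)
From mathcomp Require Import all_boot.
From mathcomp Require Import boolp classical_sets cardinality.

Set Implicit Arguments.
Unset Strict Implicit.
Unset Printing Implicit Defensive.

Local Open Scope classical_set_scope.
Local Open Scope group_scope.

Section Green.
Variable S : semigroupType.
Implicit Types (a b : S) (s t : option S).

(* An element of S^1 is encoded as [option S], [None] being the adjoined
   identity.  When S already has an identity the ideals below are unchanged,
   so no case distinction on S is needed. *)
Definition lmul1 s a : S := if s is Some x then x * a else a.
Definition rmul1 a s : S := if s is Some x then a * x else a.

Definition principal_left_ideal a : set S := [set lmul1 s a | s in [set: option S]].
Definition principal_right_ideal a : set S := [set rmul1 a t | t in [set: option S]].
Definition principal_ideal a : set S :=
  [set rmul1 (lmul1 s a) t | s in [set: option S] & t in [set: option S]].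

Definition greenL a b : Prop := principal_left_ideal a = principal_left_ideal b.
Definition greenR a b : Prop := principal_right_ideal a = principal_right_ideal b.
Definition greenJ a b : Prop := principal_ideal a = principal_ideal b.
Definition greenH a b : Prop := greenL a b /\ greenR a b.

Definition subsemigroup (T : set S) : Prop :=
  forall x y, T x -> T y -> T (x * y).

Definition finitely_generated : Prop :=
  exists2 X : set S, finite_set X & smallest subsemigroup X = [set: S].

Definition is_zero (z : S) : Prop := forall x : S, z * x = z /\ x * z = z.

(* The empty word has no value in a semigroup. *)
Definition word_value (A : Type) (f : A -> S) (u : seq A) : option S :=
  if u is y :: v then Some (foldl (fun x y' => x * f y') (f y) v) else None.

End Green.

Definition green_relation : Type := forall S : semigroupType, S -> S -> Prop.

Definition rel_finite (K : green_relation) (S : semigroupType) : Prop :=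
  finite_set [set [set b | K S a b] | a in [set: S]].

(* Varieties are given as predicates on semigroups. *)
Definition locally_finite_for (K : green_relation) (V : semigroupType -> Prop) : Prop :=
  forall S : semigroupType, V S -> finitely_generated S -> rel_finite K S.

Definition locally_H_finite := locally_finite_for greenH.
Definition locally_J_finite := locally_finite_for greenJ.

(* [u = 0] *)
Definition variety_zero (A : Type) (u : seq A) (S : semigroupType) : Prop :=
  exists2 z : S, is_zero z & forall f : A -> S, word_value f u = Some z.

(* Main.v *)
From HB Require Import structures.
Require Import Defs.
From mathcomp Require Import all_boot.
From mathcomp Require Import boolp classical_sets cardinality.

(** Fix a finite alphabet T and consider the words over T having no factor that
    is a value of u under a substitution by nonempty words.  Adjoining a zero,
    to which every product with a forbidden factor is sent, turns these words
    into the relatively free semigroup of [u = 0] on T ([avoider] below).  It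
    is J-trivial ([avoider_greenJ]), because multiplying a word by something
    either makes it strictly longer or kills it.  So if the variety is locally
    J-finite, only finitely many words over T avoid u.

    On the other hand every member of the variety generated by the images of
    the letters of T is a homomorphic image of that semigroup
    ([eval_word_onto]), hence is itself finite, and a finite semigroup has
    finitely many classes for any equivalence relation.  Thus a locally J-finite
    variety [u = 0] is even locally finite. *)

Set Implicit Arguments.
Unset Strict Implicit.
Unset Printing Implicit Defensive.

Local Open Scope classical_set_scope.
Local Open Scope group_scope.

(** * Words containing a value of u *)

Section Avoidance.
Variables (A : Type) (T : eqType) (u : seq A).
Implicit Types (w x y : seq T).

(** Nonemptiness is required only at the letters of u: a nonzero value of u in a
    semigroup with zero shows only that these letters have nonzero values. *)
Definition contains_value w : bool :=
  `[< exists2 f : A -> seq T, all (fun a => f a != [::]) u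
        & infix (flatten (map f u)) w >].

Lemma contains_value_infix w x :
  infix w x -> contains_value w -> contains_value x.
Proof.
move=> wx /asboolP[f fN0 fw]; apply/asboolP; exists f => //.
exact: infix_trans wx.
Qed.

Lemma contains_value_catl x y : contains_value x -> contains_value (x ++ y).
Proof. exact/contains_value_infix/prefix_infix. Qed.

Lemma contains_value_catr x y : contains_value y -> contains_value (x ++ y).
Proof. exact/contains_value_infix/suffix_infix. Qed.

End Avoidance.

(** * The relatively free semigroup of words avoiding u *)

Section Avoider.
Variables (A : Type) (T : choiceType) (u : seq A).

(** The empty word, which has no other use in a semigroup, encodes the zero. *)
Record avoider := Avoider {
  avoider_word :> seq T;
  _ : (avoider_word == [::]) || ~~ contains_value u avoider_word }.

HB.instance Definition _ := [isSub for avoider_word].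
HB.instance Definition _ := [Choice of avoider by <:].

Definition kill (w : seq T) : seq T := if contains_value u w then [::] else w.

Lemma kill_subproof w : (kill w == [::]) || ~~ contains_value u (kill w).
Proof. by rewrite /kill; case: ifP => //= ->; rewrite orbT. Qed.

Definition avoider_of (w : seq T) : avoider := Avoider (kill_subproof w).

Definition cat0 (x y : seq T) : seq T :=
  if (x == [::]) || (y == [::]) then [::] else kill (x ++ y).

Lemma cat0s0 x : cat0 x [::] = [::]. Proof. by rewrite /cat0 orbT. Qed.

(** Both bracketings kill exactly when the whole word is forbidden, since
    a word with a forbidden factor is forbidden. *)
Lemma cat0A : associative cat0.
Proof.
move=> x y z; rewrite /cat0 /kill.
have [->|x0] //= := eqVneq x [::].
have [->|y0] //= := eqVneq y [::].
have [->|z0] /= := eqVneq z [::]; first by rewrite orbT.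
have [/negbTE xy0 /negbTE yz0] : x ++ y != [::] /\ y ++ z != [::].
  by case: (x) (y) x0 y0 => // ? ? [].
case: (boolP (contains_value u (x ++ y))) => [xy|_];
  case: (boolP (contains_value u (y ++ z))) => [yz|_] //=.
- by rewrite yz0 catA contains_value_catl.
- by rewrite xy0 -catA contains_value_catr.
- by rewrite xy0 yz0 catA.
Qed.

Lemma avoider_mul_subproof (x y : avoider) :
  (cat0 x y == [::]) || ~~ contains_value u (cat0 x y).
Proof. by rewrite /cat0; case: ifP => // _; exact: kill_subproof. Qed.

Definition avoider_mul (x y : avoider) := Avoider (avoider_mul_subproof x y).

Lemma avoider_mulA : associative avoider_mul.
Proof. by move=> x y z; apply: val_inj; apply: cat0A. Qed.

HB.instance Definition _ := isSemigroup.Build avoider avoider_mulA.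

Definition avoider0 : avoider := @Avoider [::] isT.

Lemma avoider_mulE (x y : avoider) : (x * y : avoider) = cat0 x y :> seq T.
Proof. by []. Qed.

Lemma avoider0_zero : is_zero avoider0.
Proof. by move=> x; split; apply: val_inj => //=; rewrite cat0s0. Qed.

(** A product that is not killed is a genuine concatenation. *)
Lemma avoider_mul_cases (x y : avoider) :
  (x * y : avoider) = [::] :> seq T \/
  [/\ x != [::] :> seq T, y != [::] :> seq T &
      (x * y : avoider) = x ++ y :> seq T].
Proof.
rewrite avoider_mulE /cat0 /kill.
have [_|x0] /= := eqVneq (x : seq T) [::]; first by left.
have [_|y0] /= := eqVneq (y : seq T) [::]; first by left.
by case: ifP => _; [left|right].
Qed.

Lemma foldl_avoider0 (f : A -> avoider) (v : seq A) :
  foldl (fun y a => y * f a) avoider0 v = avoider0.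
Proof. by elim: v => //= a v; rewrite (avoider0_zero (f a)).1. Qed.

Lemma avoider_prod_cases (f : A -> avoider) (x : avoider) (v : seq A) :
  x != [::] :> seq T ->
  let p := foldl (fun y a => y * f a) x v in
  p = [::] :> seq T \/
  all (fun a => f a != [::] :> seq T) v /\
  p = x ++ flatten (map (fun a => f a : seq T) v) :> seq T.
Proof.
elim: v x => [|a v IHv] x x0 /=; first by right; rewrite cats0.
have [xa0|[_ fa0 xaE]] := avoider_mul_cases x (f a).
  have -> : x * f a = avoider0 by apply: val_inj.
  by rewrite foldl_avoider0; left.
have /IHv[->|[fN0 ->]] : x * f a != [::] :> seq T.
- by rewrite xaE; case: (x : seq T) x0.
- by left.
by right; rewrite fa0 fN0 xaE catA.
Qed.

(** A substitution of nonzero elements either produces 0 on the way, or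
    produces a word that is itself a value of u; no element is such a word. *)
Lemma avoider_variety : u <> [::] -> variety_zero u avoider.
Proof.
move=> u_neq0; exists avoider0 => [|f]; first exact: avoider0_zero.
have [a [v uE]] : exists a v, u = a :: v.
  by move: u_neq0; case: (u) => // a v _; exists a, v.
rewrite uE /=; congr Some; apply: val_inj => /=.
have [fa0|fa0] := eqVneq (f a : seq T) [::].
  have -> : f a = avoider0 by apply: val_inj.
  by rewrite foldl_avoider0.
have [//|[fN0 pE]] := avoider_prod_cases f v fa0.
have := valP (foldl (fun y b => y * f b) (f a) v).
case/orP=> [/eqP//|/negP[]] /=.
apply/asboolP; exists (fun b => f b : seq T); first by rewrite uE /= fa0.
by rewrite pE uE infix_refl.
Qed.

(** Nonzero products contain all their factors, so divisibility of nonzero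
    elements implies the factor order on words. *)
Lemma avoider_ideal (x y : avoider) : principal_ideal y x ->
  x = [::] :> seq T \/ infix y x /\ y != [::] :> seq T.
Proof.
have mulP (p q r : avoider) : (r = p :> avoider \/ r = q) ->
    p * q = [::] :> seq T \/ infix r (p * q : avoider) /\ r != [::] :> seq T.
  move=> rE; have [|[p0 q0 ->]] := avoider_mul_cases p q; first by left.
  by right; case: rE => ->; rewrite ?prefix_infix ?suffix_infix.
have zeroP (z : avoider) :
    z = [::] :> seq T \/ infix y z /\ y != [::] :> seq T ->
    forall t, rmul1 z t = [::] :> seq T \/
      infix y (rmul1 z t) /\ y != [::] :> seq T.
  move=> zP [t|//=]; have /= [|[zzt z0]] := mulP z t z (or_introl erefl).
    by left.
  case: zP => [z0'|[yz y0]]; first by rewrite z0' in z0.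
  by right; rewrite (infix_trans yz zzt).
case=> s _ [t _ <-]; apply: zeroP; case: s => [s|] /=.
  by apply: mulP; right.
by have [->|y0] := eqVneq (y : seq T) [::]; [left|right; rewrite infix_refl].
Qed.

Lemma mem_principal_ideal (S : semigroupType) (x : S) : principal_ideal x x.
Proof. by exists None => //; exists None. Qed.

(** Two words that are factors of each other have the same length, hence are
    equal. *)
Lemma avoider_greenJ (x y : avoider) : greenJ x y -> x = y.
Proof.
move=> xyJ; apply: val_inj => /=.
have /avoider_ideal xP : principal_ideal y x.
  by rewrite -xyJ; exact: mem_principal_ideal.
have /avoider_ideal yP : principal_ideal x y.
  by rewrite xyJ; exact: mem_principal_ideal.
case: xP yP => [xE|[yx y0]] [yE|[xy x0]].
- by rewrite xE yE.
- by rewrite xE in x0.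
- by rewrite yE in y0.
have yx_size := size_subseq_leqif (infixW yx).
by apply/esym/eqP; rewrite -yx_size eqn_leq !size_infix.
Qed.

End Avoider.

(** By J-triviality an element is determined by its J-class. *)
Lemma avoider_J_finite (A : Type) (T : choiceType) (u : seq A) :
  rel_finite greenJ (avoider T u) -> finite_set [set: avoider T u].
Proof.
move=> J_fin; pose J (x : avoider T u) := [set y | greenJ x y].
have J_inj : injective J.
  move=> x y xyJ; apply: avoider_greenJ.
  suff : J x y by [].
  by rewrite xyJ.
rewrite -(eq_finite_set (inj_card_eq (in2W J_inj))).
exact: J_fin.
Qed.

(** The zero is included among the generators because over the empty alphabet it
    is not a product of letters. *)
Lemma avoider_finitely_generated (A : Type) (T : finType) (u : seq A) :
  finitely_generated (avoider T u).
Proof.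
pose X : set (avoider T u) :=
  avoider0 T u |` [set avoider_of u [:: t] | t in [set: T]].
exists X; first by rewrite finite_setU; split => //; apply: finite_image.
apply/seteqP; split => // x _ B [Bsub XB].
have B0 : B (avoider0 T u) by apply: XB; left.
have Bletter t : B (avoider_of u [:: t]) by apply: XB; right; exists t.
have Bword w : B (avoider_of u w).
  elim: w => [|t w IHw].
    have -> // : avoider_of u [::] = avoider0 T u.
    by apply: val_inj; rewrite /= /kill if_same.
  have [->//|w0] := eqVneq w [::].
  have [bad|good] := boolP (contains_value u (t :: w)).
    have -> : avoider_of u (t :: w) = avoider0 T u.
      by apply: val_inj; rewrite /= /kill bad.
    exact: B0.
  have -> : avoider_of u (t :: w) = avoider_of u [:: t] * avoider_of u w.
    have t_good : contains_value u [:: t] = false.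
      by apply: contraNF good; apply: (@contains_value_catl _ _ _ [:: t] w).
    have w_good : contains_value u w = false.
      by apply: contraNF good; apply: (@contains_value_catr _ _ _ [:: t] w).
    apply: val_inj; rewrite /= /cat0 /kill t_good w_good (negbTE w0) /=.
    by rewrite (negbTE good).
  exact: Bsub.
suff -> : x = avoider_of u x by [].
apply: val_inj; rewrite /= /kill.
by have /orP[/eqP->|/negbTE->] := valP x; rewrite ?if_same.
Qed.

(** * Members of the variety as quotients *)

Section Evaluation.
Variables (T : Type) (S : semigroupType) (z : S) (g : T -> S).

(** The default z for the empty word matches its role as the zero of
    [avoider]. *)
Definition eval_word (w : seq T) : S := odflt z (word_value g w).

Lemma foldl_mulg (x y : S) (w : seq T) :
  foldl (fun p t => p * g t) (x * y) w = x * foldl (fun p t => p * g t) y w.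
Proof. by elim: w y => //= t w IHw y; rewrite -mulgA IHw. Qed.

Lemma eval_word_cat (w x : seq T) : w <> [::] -> x <> [::] ->
  eval_word (w ++ x) = eval_word w * eval_word x.
Proof.
case: w => // s w _; case: x => // t x _.
by rewrite /eval_word /= foldl_cat /= foldl_mulg.
Qed.

End Evaluation.

(** A value of u, once evaluated, is again a value of u, under the composite
    substitution; this is why it becomes zero in members of [u = 0]. *)
Lemma eval_word_flatten (A : Type) (T : eqType) (S : semigroupType) (z : S)
    (g : T -> S) (f : A -> seq T) (u : seq A) : all (fun a => f a != [::]) u ->
  eval_word z g (flatten (map f u)) =
    eval_word z (fun a => eval_word z g (f a)) u.
Proof.
elim: u => //= a v IHv /andP[/eqP fa0 fv0].
case: v fv0 IHv => [|b v] fv0 IHv; first by rewrite /= cats0.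
rewrite eval_word_cat ?IHv //.
  by rewrite -(@eval_word_cat _ _ z (fun a => eval_word z g (f a)) [:: a]).
by move: fv0 => /=; case: (f b).
Qed.

Section Quotient.
Variables (A : Type) (u : seq A) (T : choiceType) (S : semigroupType).
Variables (z : S) (g : T -> S).
Hypotheses (u_neq0 : u <> [::]) (z_zero : is_zero z).
Hypothesis uz : forall f : A -> S, word_value f u = Some z.

Lemma eval_contains_value (w : seq T) :
  contains_value u w -> eval_word z g w = z.
Proof.
case/asboolP=> f fN0 /infixP[p [q ->]].
have fu : eval_word z g (flatten (map f u)) = z.
  by rewrite eval_word_flatten // /eval_word uz.
have fu0 : flatten (map f u) <> [::].
  by case: (u) u_neq0 fN0 => //= a v _ /andP[]; case: (f a).
have fuq : eval_word z g (flatten (map f u) ++ q) = z.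
  have [->|/eqP q0] := eqVneq q [::]; first by rewrite cats0.
  by rewrite eval_word_cat // fu (z_zero _).1.
have [->//|/eqP p0] := eqVneq p [::].
rewrite eval_word_cat // ?fuq ?(z_zero _).2 //.
by case: flatten fu0.
Qed.

Lemma eval_avoider_of (w : seq T) :
  eval_word z g (avoider_of u w) = eval_word z g w.
Proof. by rewrite /= /kill; case: ifP => // /eval_contains_value->. Qed.

(** The image of evaluation on words avoiding u is closed under products since
    evaluation already vanishes on the words that get killed. *)
Lemma eval_word_onto (X : set S) : X `<=` range g ->
    smallest (@subsemigroup S) X = [set: S] ->
  [set eval_word z g x | x in [set: avoider T u]] = [set: S].
Proof.
move=> Xg genX; apply/seteqP; split=> //; rewrite -genX; apply: smallest_sub.
  move=> _ _ [x _ <-] [y _ <-].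
  have [->|/eqP x0] := eqVneq (x : seq T) [::].
    by exists (avoider0 T u); rewrite //= (z_zero _).1.
  have [->|/eqP y0] := eqVneq (y : seq T) [::].
    by exists (avoider0 T u); rewrite //= (z_zero _).2.
  by exists (avoider_of u (x ++ y)); rewrite // eval_avoider_of eval_word_cat.
move=> s /Xg[t _ <-].
by exists (avoider_of u [:: t]); rewrite // eval_avoider_of.
Qed.

End Quotient.

Theorem proposition4p17 (A : Type) (u : seq A) (u_nonempty : u <> [::]) :
  locally_H_finite (variety_zero u) \/ ~ locally_J_finite (variety_zero u).
Proof.
have [J_fin|] := pselect (locally_J_finite (variety_zero u)); last by right.
left=> S [z z_zero uz] [X X_fin genX].
have /finite_seqP[s sX] := X_fin.
pose g (i : 'I_(size s)) : S := tnth (in_tuple s) i.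
have Xg : X `<=` range g.
  rewrite sX => x /= xs; have /tnthP[i ->] : x \in in_tuple s by [].
  by exists i.
have avoider_fin : finite_set [set: avoider 'I_(size s) u].
  apply/avoider_J_finite/J_fin; first exact: avoider_variety.
  exact: avoider_finitely_generated.
apply: finite_image.
by rewrite -(eval_word_onto u_nonempty z_zero uz Xg genX); apply: finite_image.
Qed.
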